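(* Let $t\colon X\to(\mathcal{D}X+\{\star\})^A$ be a reactive probabilistic labelled transition system (RPLTS) and let $\tilde t\colon X\to(\mathcal{P}\mathcal{D}X)^A$ be the NPLTS with $\tilde t(x)(a)=\{t(x)(a)\}$ if $t(x)(a)\neq\star$ and $\tilde t(x)(a)=\emptyset$ if $t(x)(a)=\star$. Then the RPLTS trace equivalence $\equiv^{RP}$ of $t$, the may-must trace equivalence $\equiv$ of $\tilde t$, the may trace equivalence $\equiv_B$ of $\tilde t$ and the must trace equivalence $\equiv_T$ of $\tilde t$ all coincide.
   Context: $\mathcal{D}X$ is the set of finitely supported probability distributions on $X$, $\delta_x$ the Dirac distribution. RPLTS trace equivalence: for $\Phi\in\mathcal D(X+\{\star\})$ and label $a$ let $\Phi^a=\sum_{u\in\mathrm{supp}\Phi}\Phi(u)\,\theta(u,a)$ where $\theta(\star,a)=\delta_\star$, $\theta(x,a)=\delta_\star$ if $t(x)(a)=\star$, and $\theta(x,a)$ is $t(x)(a)$ viewed as a distribution on $X+\{\star\}$ otherwise; set $\Phi^\varepsilon=\Phi$, $\Phi^{aw}=(\Phi^a)^w$; then $x\equiv^{RP}y$ iff $1-(\delta_x)^w(\star)=1-(\delta_y)^w(\star)$ for all $w\in A^*$. For an NPLTS $(X,t')$ with $t'\colon X\to(\mathcal P\mathcal D X)^A$ (finite sets of distributions): terms $s::=x\mid\star\mid s\oplus s\mid s+_ps\ (p\in[0,1])$; for a finite set $S$ of distributions, $\tau(S)=\star$ if $S=\emptyset$, else $\tau(\{\Delta_1,\dots,\Delta_n\})=d_1\oplus\cdots\oplus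 d_n$ with $d_i$ a $+_p$-term over $X$ denoting $\Delta_i$ (reading $x$ as $\delta_x$; the semantics does not depend on the choice). For each label $a$: $x^a=\tau(t'(x)(a))$, $\star^a=\star$, $(s_1\oplus s_2)^a=s_1^a\oplus s_2^a$, $(s_1+_ps_2)^a=s_1^a+_ps_2^a$; $s^\varepsilon=s$, $s^{aw}=(s^a)^w$. Outputs: $o_B$: $x\mapsto1$, $\star\mapsto0$, $\oplus\mapsto\max$, $+_p\mapsto p\cdot-+(1-p)\cdot-$; $o_T$: same with $\min$; $o$ into closed intervals of $[0,1]$: $x\mapsto[1,1]$, $\star\mapsto[0,0]$, $\oplus\mapsto[\min$ of lower ends$,\max$ of upper ends$]$, $+_p\mapsto$ endpoint-wise convex combination. $x\equiv y$ iff $o(x^w)=o(y^w)$ for all $w$; $x\equiv_B y$ iff $o_B(x^w)=o_B(y^w)$ for all $w$; $x\equiv_T y$ iff $o_T(x^w)=o_T(y^w)$ for all $w$. *)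

(* Defs.v *)
From HB Require Import structures.
From mathcomp Require Import all_boot all_order all_algebra.
From mathcomp Require Import interval_inference.
From mathcomp Require Import finmap.
From mathcomp Require Import boolp reals.
From mathcomp Require Import ring.
Set Implicit Arguments.
Unset Strict Implicit.
Unset Printing Implicit Defensive.
Import Order.TTheory GRing.Theory Num.Theory.
Local Open Scope fset_scope.
Local Open Scope ring_scope.

Section Distributions.
Variable R : realType.

Definition is_dist (T : choiceType) (f : {fsfun T -> R with 0}) : bool :=
  all (fun x => 0 <= f x) (finsupp f) && (\sum_(x <- finsupp f) f x == 1).

Record dist (T : choiceType) :=
  Dist { dist_fun :> {fsfun T -> R with 0}; _ : is_dist dist_fun }.

HB.instance Definition _ (T : choiceType) := [isSub for @dist_fun T].
HB.instance Definition _ (T : choiceType) := [Choice of dist T by <:].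

Lemma dist_ge0 (T : choiceType) (D : dist T) x : 0 <= D x.
Proof.
case: D => f /= /andP[/allP fge0 _].
by case: (finsuppP f x) => // /fge0.
Qed.

Lemma sum_fsupp (T : choiceType) (f : {fsfun T -> R with 0}) (S : {fset T})
    (g : T -> R) :
  finsupp f `<=` S ->
  \sum_(x <- finsupp f) f x * g x = \sum_(x <- S) f x * g x.
Proof.
move=> fS; apply: big_fset_incl => // x _ xf.
by rewrite fsfun_dflt ?mul0r.
Qed.

Lemma dist_sum (T : choiceType) (D : dist T) (S : {fset T}) :
  finsupp D `<=` S -> \sum_(x <- S) D x = 1.
Proof.
move=> DS; have := sum_fsupp (fun=> 1) DS.
under eq_bigr do rewrite mulr1.
under [RHS]eq_bigr do rewrite mulr1.
by move=> <-; case: D {DS} => f /= /andP[_ /eqP].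
Qed.

Lemma is_dist_fsfun (T : choiceType) (S : {fset T}) (w : T -> R) :
  (forall x, 0 <= w x) -> \sum_(x <- S) w x = 1 ->
  is_dist [fsfun x in S => w x | 0].
Proof.
move=> w0 w1; apply/andP; split.
  by apply/allP => x _; rewrite fsfunE; case: ifP.
apply/eqP; rewrite -w1.
have fS : finsupp [fsfun x in S => w x | 0] `<=` S by exact: finsupp_sub.
have := sum_fsupp (fun=> 1) fS.
under eq_bigr do rewrite mulr1.
under [RHS]eq_bigr do rewrite mulr1.
move=> ->; apply: eq_big_seq => x xS.
by rewrite fsfunE xS.
Qed.

Lemma dirac_subproof (T : choiceType) (x : T) :
  is_dist [fsfun y in [fset x] => (y == x)%:R | 0].
Proof.
apply: is_dist_fsfun => [y|]; first exact: ler0n.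
by rewrite big_seq_fset1 eqxx.
Qed.

Definition dirac (T : choiceType) (x : T) : dist T := Dist (dirac_subproof x).

Lemma diracE (T : choiceType) (x y : T) : dirac x y = (y == x)%:R.
Proof. by rewrite fsfunE inE; case: eqP. Qed.

Lemma dbind_subproof (T U : choiceType) (P : dist T) (f : T -> dist U) :
  is_dist [fsfun v in \bigcup_(u <- finsupp P) finsupp (f u) =>
             \sum_(u <- finsupp P) P u * f u v | 0].
Proof.
apply: is_dist_fsfun => [v|].
  by apply: sumr_ge0 => u _; rewrite mulr_ge0 ?dist_ge0.
rewrite exchange_big /= -[RHS](dist_sum (fsubset_refl (finsupp P))).
apply: eq_big_seq => u uP; rewrite -mulr_sumr dist_sum ?mulr1 //.
by apply: bigfcup_sup uP _.
Qed.

(* The convex combination \sum_u P(u) f(u) of the distributions f(u). *)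
Definition dbind (T U : choiceType) (P : dist T) (f : T -> dist U) : dist U :=
  Dist (dbind_subproof P f).

Lemma dbindE (T U : choiceType) (P : dist T) (f : T -> dist U) v :
  dbind P f v = \sum_(u <- finsupp P) P u * f u v.
Proof.
rewrite fsfunE; case: ifPn => // vS; rewrite big_seq big1 // => u uP.
rewrite (@fsfun_dflt _ _ _ (f u)) ?mulr0 //.
apply: contra vS => vf; apply/bigfcupP; exists u => //.
by rewrite uP.
Qed.

Lemma dmix_subproof (T : choiceType) (p : {i01 R}) (D E : dist T) :
  is_dist [fsfun x in finsupp D `|` finsupp E =>
             p%:num * D x + (1 - p%:num) * E x | 0].
Proof.
apply: is_dist_fsfun => [x|].
  by rewrite addr_ge0 // mulr_ge0 ?dist_ge0 // subr_ge0.
rewrite big_split -!mulr_sumr /= !dist_sum ?fsubsetUl ?fsubsetUr //.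
by rewrite !mulr1 addrC subrK.
Qed.

Definition dmix (T : choiceType) (p : {i01 R}) (D E : dist T) : dist T :=
  Dist (dmix_subproof p D E).

Lemma dmixE (T : choiceType) (p : {i01 R}) (D E : dist T) x :
  dmix p D E x = p%:num * D x + (1 - p%:num) * E x.
Proof.
rewrite fsfunE; case: ifPn => //; rewrite inE negb_or => /andP[xD xE].
by rewrite !fsfun_dflt // !mulr0 addr0.
Qed.

Definition dmap (T U : choiceType) (h : T -> U) (P : dist T) : dist U :=
  dbind P (fun x => dirac (h x)).

Lemma dmap_SomeE (T : choiceType) (P : dist T) x :
  dmap Some P (Some x) = P x.
Proof.
rewrite dbindE.
rewrite (sum_fsupp (fun y => dirac (Some y) (Some x))
  (fsubsetUr [fset x] (finsupp P))).
rewrite (big_fsetD1 x) ?inE ?eqxx //= diracE eqxx mulr1 big1_fset ?addr0 //.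
move=> y; rewrite !inE => /andP[yx _] _.
by rewrite diracE (inj_eq Some_inj) eq_sym (negPf yx) mulr0.
Qed.

Lemma dmap_SomeN (T : choiceType) (P : dist T) : dmap Some P None = 0.
Proof.
by rewrite dbindE big1 // => y _; rewrite diracE mulr0.
Qed.

End Distributions.

Section Terms.
Variables (R : realType) (X : choiceType).

Inductive term :=
  | TVar of X
  | TStar
  | TPlus of term & term
  | TMix of {i01 R} & term & term.

(* Terms built from variables and the operations +_p only. *)
Inductive pterm :=
  | PVar of X
  | PMix of {i01 R} & pterm & pterm.

Fixpoint pterm_term (d : pterm) : term :=
  match d with
  | PVar x => TVar x
  | PMix p d1 d2 => TMix p (pterm_term d1) (pterm_term d2)
  end.

Fixpoint pterm_dist (d : pterm) : dist R X :=
  match d with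
  | PVar x => dirac R x
  | PMix p d1 d2 => dmix p (pterm_dist d1) (pterm_dist d2)
  end.

(* [is_tau tau]: on every finite set S = {D_1, ..., D_n} of distributions, tau
   picks one of the admissible terms d_1 (+) ... (+) d_n.  The terms d_i
   denoting the D_i and the order of the summands are left open, and repetitions
   are allowed; [tau_exists] below shows that such a tau exists. *)
Definition is_tau (tau : {fset dist R X} -> term) : Prop :=
  tau fset0 = TStar /\
  forall S : {fset dist R X}, S != fset0 ->
    exists (d : pterm) (ds : seq pterm),
      tau S = foldl TPlus (pterm_term d) (map pterm_term ds) /\
      map pterm_dist (d :: ds) =i S.

End Terms.

Arguments TStar {R X}.

Section TauExists.
Variables (R : realType) (X : choiceType).

Let pterm_of_weights (w : X -> R) (s : seq X) :
  (forall x, 0 <= w x) -> 0 < \sum_(x <- s) w x ->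
  exists d : pterm R X, forall y,
    (\sum_(x <- s) w x) * pterm_dist d y = \sum_(x <- s) w x * (y == x)%:R.
Proof.
move=> w0; elim: s => [|x s IH]; rewrite ?big_nil ?ltxx // !big_cons => tot0.
have s0 : 0 <= \sum_(x <- s) w x by exact: sumr_ge0.
have [s1|] := ltP 0 (\sum_(x <- s) w x); last first.
  move=> s1; have sE : \sum_(x <- s) w x = 0 by apply/le_anti; rewrite s1 s0.
  exists (PVar R x) => y; rewrite [LHS]/= big_cons sE addr0 diracE.
  rewrite [X in _ = _ + X]big1_seq ?addr0 // => z /= zs.
  move/eqP: sE; rewrite psumr_eq0 // => /allP/(_ z zs)/eqP ->.
  by rewrite mul0r.
have [d dE] := IH s1.
set W := _ + _ in tot0 *.
have W0 : W != 0 by exact: lt0r_neq0.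
have p0 : 0 <= w x / W by rewrite divr_ge0 // ltW.
have p1 : w x / W <= 1 by rewrite ler_pdivrMr // mul1r lerDl.
exists (PMix (Itv01 p0 p1) (PVar R x) d) => y.
rewrite big_cons -dE [pterm_dist _]/= dmixE diracE /=.
have -> : \sum_(j <- s) w j = W - w x by rewrite /W addrC addKr.
by field.
Qed.

Lemma pterm_dist_surj (D : dist R X) : exists d, pterm_dist d = D.
Proof.
have D1 := dist_sum (fsubset_refl (finsupp D)).
have [|d dE] := pterm_of_weights (s := finsupp D) (dist_ge0 D).
  by rewrite D1.
exists d; apply: val_inj; apply/fsfunP => x.
have := dE x; rewrite D1 mul1r => ->.
rewrite (sum_fsupp (fun y => (x == y)%:R) (fsubsetUr [fset x] (finsupp D))).
rewrite (big_fsetD1 x) ?inE ?eqxx //= mulr1 big1_fset ?addr0 //.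
by move=> y; rewrite !inE => /andP[yx _] _; rewrite eq_sym (negPf yx) mulr0.
Qed.

Lemma tau_exists : exists tau : {fset dist R X} -> term R X, is_tau tau.
Proof.
have pick D := cid (pterm_dist_surj D).
pose h D := projT1 (pick D).
have hE D : pterm_dist (h D) = D by rewrite /h; case: (pick D).
exists (fun S => if enum_fset S is D :: Ds then
          foldl (@TPlus R X) (pterm_term (h D)) [seq pterm_term (h E) | E <- Ds]
        else TStar); split=> [|S S0].
  case E : (enum_fset _) => [//|D s].
  have D0 : D \in enum_fset (fset0 : {fset dist R X}) by rewrite E mem_head.
  by have := in_fset0 D; rewrite [_ \in _]D0.
case E : (enum_fset S) => [|D Ds].
  case/fset0Pn: S0 => D DS.
  have : D \in enum_fset S by [].
  by rewrite E.
exists (h D), (map h Ds); split; first by rewrite -map_comp.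
move=> F; rewrite -map_cons -map_comp (eq_map (g := id)) ?map_id => [|G] /=.
  by rewrite -[D :: Ds]E.
exact: hE.
Qed.

End TauExists.

Section Traces.
Variables (R : realType) (A : Type) (X : choiceType).

Definition rplts := X -> A -> option (dist R X).
Definition nplts := X -> A -> {fset dist R X}.

(* In [option X], the element [None] stands for the star. *)
Definition theta (t : rplts) (a : A) (u : option X) : dist R (option X) :=
  match u with
  | None => dirac R None
  | Some x => if t x a is Some D then dmap Some D else dirac R None
  end.

Definition rp_step (t : rplts) (P : dist R (option X)) (a : A) :=
  dbind P (theta t a).

Definition rp_run (t : rplts) (P : dist R (option X)) (w : seq A) :=
  foldl (rp_step t) P w.

Definition rp_equiv (t : rplts) (x y : X) : Prop :=
  forall w : seq A,
    1 - rp_run t (dirac R (Some x)) w None =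
    1 - rp_run t (dirac R (Some y)) w None.

Fixpoint term_step (tau : {fset dist R X} -> term R X) (t' : nplts)
    (s : term R X) (a : A) : term R X :=
  match s with
  | TVar x => tau (t' x a)
  | TStar => TStar
  | TPlus s1 s2 => TPlus (term_step tau t' s1 a) (term_step tau t' s2 a)
  | TMix p s1 s2 => TMix p (term_step tau t' s1 a) (term_step tau t' s2 a)
  end.

Definition term_run tau (t' : nplts) (s : term R X) (w : seq A) : term R X :=
  foldl (term_step tau t') s w.

End Traces.

Section Outputs.
Variables (R : realType) (X : choiceType).

Fixpoint out_may (s : term R X) : R :=
  match s with
  | TVar _ => 1
  | TStar => 0
  | TPlus s1 s2 => Num.max (out_may s1) (out_may s2)
  | TMix p s1 s2 => p%:num * out_may s1 + (1 - p%:num) * out_may s2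
  end.

Fixpoint out_must (s : term R X) : R :=
  match s with
  | TVar _ => 1
  | TStar => 0
  | TPlus s1 s2 => Num.min (out_must s1) (out_must s2)
  | TMix p s1 s2 => p%:num * out_must s1 + (1 - p%:num) * out_must s2
  end.

(* The nonempty closed interval [lo, hi] inside [0, 1], by its endpoints. *)
Record itv01 := MkItv01 { lo : R; hi : R; _ : [&& 0 <= lo, lo <= hi & hi <= 1] }.

Lemma itv01P (I : itv01) : [/\ 0 <= lo I, lo I <= hi I & hi I <= 1].
Proof. by case: I => l h /= /and3P. Qed.

Lemma itv01_inj (I J : itv01) : lo I = lo J -> hi I = hi J -> I = J.
Proof.
by case: I J => [a b p] [c d q] /= ac bd; subst; rewrite (bool_irrelevance p q).
Qed.

Lemma itv_one_subproof : [&& 0 <= (1 : R), 1 <= (1 : R) & 1 <= (1 : R)].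
Proof. by rewrite ler01 lexx. Qed.

Definition itv_one : itv01 := MkItv01 itv_one_subproof.

Lemma itv_zero_subproof : [&& 0 <= (0 : R), 0 <= (0 : R) & 0 <= (1 : R)].
Proof. by rewrite lexx ler01. Qed.

Definition itv_zero : itv01 := MkItv01 itv_zero_subproof.

Lemma itv_hull_subproof (I J : itv01) :
  [&& 0 <= Num.min (lo I) (lo J),
      Num.min (lo I) (lo J) <= Num.max (hi I) (hi J)
    & Num.max (hi I) (hi J) <= 1].
Proof.
have [l0 lh h1] := itv01P I; have [l0' lh' h1'] := itv01P J.
by rewrite le_min l0 l0' ge_max h1 h1' ge_min le_max lh.
Qed.

Definition itv_hull (I J : itv01) : itv01 := MkItv01 (itv_hull_subproof I J).

Lemma itv_mix_subproof (p : {i01 R}) (I J : itv01) :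
  [&& 0 <= p%:num * lo I + (1 - p%:num) * lo J,
      p%:num * lo I + (1 - p%:num) * lo J
        <= p%:num * hi I + (1 - p%:num) * hi J
    & p%:num * hi I + (1 - p%:num) * hi J <= 1].
Proof.
have [l0 lh h1] := itv01P I; have [l0' lh' h1'] := itv01P J.
have p0 : 0 <= p%:num by [].
have p1 : 0 <= 1 - p%:num by rewrite subr_ge0.
apply/and3P; split; first by rewrite addr_ge0 ?mulr_ge0.
  by rewrite lerD // ler_wpM2l.
rewrite [leRHS](_ : _ = p%:num * 1 + (1 - p%:num) * 1).
  by rewrite lerD // ler_wpM2l.
by rewrite !mulr1 addrC subrK.
Qed.

Definition itv_mix (p : {i01 R}) (I J : itv01) : itv01 :=
  MkItv01 (itv_mix_subproof p I J).

Fixpoint out_maymust (s : term R X) : itv01 :=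
  match s with
  | TVar _ => itv_one
  | TStar => itv_zero
  | TPlus s1 s2 => itv_hull (out_maymust s1) (out_maymust s2)
  | TMix p s1 s2 => itv_mix p (out_maymust s1) (out_maymust s2)
  end.

End Outputs.

Section Equivalences.
Variables (R : realType) (A : Type) (X : choiceType).
Variables (tau : {fset dist R X} -> term R X) (t' : nplts R A X).

Definition maymust_equiv (x y : X) : Prop :=
  forall w : seq A,
    out_maymust (term_run tau t' (TVar R x) w) =
    out_maymust (term_run tau t' (TVar R y) w).

Definition may_equiv (x y : X) : Prop :=
  forall w : seq A,
    out_may (term_run tau t' (TVar R x) w) =
    out_may (term_run tau t' (TVar R y) w).

Definition must_equiv (x y : X) : Prop :=
  forall w : seq A,
    out_must (term_run tau t' (TVar R x) w) =
    out_must (term_run tau t' (TVar R y) w).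

End Equivalences.

Definition nplts_of_rplts (R : realType) (A : Type) (X : choiceType)
    (t : rplts R A X) : nplts R A X :=
  fun x a => if t x a is Some D then [fset D] else fset0.

(* Main.v *)
Require Import Defs.
From mathcomp Require Import all_boot finmap reals.
From mathcomp Require Import order ssralg interval_inference ring.
Set Implicit Arguments.
Unset Strict Implicit.
Unset Printing Implicit Defensive.
Import Order.TTheory GRing.Theory.
Local Open Scope fset_scope.
Local Open Scope ring_scope.

(** In the determinization of [nplts_of_rplts t], the two arguments of every
    [TPlus] denote the same distribution on [option X], because each set of
    successor distributions has at most one element.  Hence every reachable term
    denotes a single distribution, the one computed by [rp_run], and max, min and
    interval hull all return its mass outside [None]. *)

Lemma dist_ext (R : realType) (T : choiceType) (P Q : dist R T) :
  P =1 Q -> P = Q.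
Proof. by move=> PQ; apply: val_inj; apply/fsfunP. Qed.

Lemma dbind_dirac (R : realType) (T U : choiceType) (f : T -> dist R U) (x : T) :
  dbind (dirac R x) f = f x.
Proof.
apply: dist_ext => v.
(* [finsupp_sub] bounds the support by the set [[fset x]] used to build [dirac], so the sum has one
   summand. *)
rewrite dbindE (sum_fsupp (fun u => f u v) (finsupp_sub _ _ _)) big_seq_fset1.
by rewrite diracE eqxx mul1r.
Qed.

(** The three sums run over different supports; over the common set [finsupp P] union [finsupp Q]
    the identity is linearity in each summand. *)
Lemma dbind_dmix (R : realType) (T U : choiceType) (p : {i01 R})
    (P Q : dist R T) (f : T -> dist R U) :
  dbind (dmix p P Q) f = dmix p (dbind P f) (dbind Q f).
Proof.
apply: dist_ext => v; rewrite dmixE !dbindE.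
rewrite (sum_fsupp (fun u => f u v) (finsupp_sub _ _ _)).
rewrite (sum_fsupp (fun u => f u v) (fsubsetUl (finsupp P) (finsupp Q))).
rewrite (sum_fsupp (fun u => f u v) (fsubsetUr (finsupp P) (finsupp Q))).
rewrite !mulr_sumr -big_split /=; apply: eq_bigr => u _.
by rewrite dmixE; ring.
Qed.

(** A relation, since a general term has no single denotation: [DenPlus] demands the same [P] on
    both sides. *)
Inductive denotes (R : realType) (X : choiceType) :
    term R X -> dist R (option X) -> Prop :=
  | DenVar x : denotes (TVar R x) (dirac R (Some x))
  | DenStar : denotes TStar (dirac R None)
  | DenPlus s1 s2 P :
      denotes s1 P -> denotes s2 P -> denotes (TPlus s1 s2) P
  | DenMix p s1 s2 P1 P2 :
      denotes s1 P1 -> denotes s2 P2 -> denotes (TMix p s1 s2) (dmix p P1 P2).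

Lemma denotes_pterm (R : realType) (X : choiceType) (d : pterm R X) :
  denotes (pterm_term d) (dmap Some (pterm_dist d)).
Proof.
elim: d => [x|p d1 IH1 d2 IH2] /=.
  by rewrite /dmap dbind_dirac; exact: DenVar.
by rewrite /dmap dbind_dmix; exact: DenMix.
Qed.

(** [is_tau] allows repetitions, so [tau [fset D]] may be a sum of several terms; each of them
    denotes [D], which is what [DenPlus] asks for. *)
Lemma denotes_tau1 (R : realType) (X : choiceType)
    (tau : {fset dist R X} -> term R X) (D : dist R X) :
  is_tau tau -> denotes (tau [fset D]) (dmap Some D).
Proof.
move=> [_ tauP].
have D0 : [fset D] != fset0 by apply/fset0Pn; exists D; rewrite inE.
have [d [ds [-> dsE]]] := tauP _ D0.
have {dsE} dD e : pterm_dist e \in map (@pterm_dist R X) (d :: ds) ->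
    pterm_dist e = D.
  by move=> ed; apply/fset1P; rewrite -(dsE (pterm_dist e)).
have : denotes (pterm_term d) (dmap Some D).
  by rewrite -(dD d) ?mem_head //; exact: denotes_pterm.
have {dD} : forall e, pterm_dist e \in map (@pterm_dist R X) ds ->
    pterm_dist e = D.
  by move=> e eds; apply: dD; rewrite inE eds orbT.
(* The head is generalized to any term denoting [dmap Some D], because it is the accumulator of
   [foldl]. *)
elim: ds (pterm_term d) => [//|e ds IH] s dD sD /=.
apply: IH => [e' e'ds|]; first by apply: dD; rewrite inE e'ds orbT.
apply: DenPlus => //.
by rewrite -(dD e) ?mem_head //; exact: denotes_pterm.
Qed.

(** [rp_step] is a [dbind], hence commutes with [dmix]; on a variable, the successor set is a
    singleton or empty. *)
Lemma denotes_step (R : realType) (A : Type) (X : choiceType)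
    (t : rplts R A X) (tau : {fset dist R X} -> term R X) s P a :
  is_tau tau -> denotes s P ->
  denotes (term_step tau (nplts_of_rplts t) s a) (rp_step t P a).
Proof.
move=> htau; rewrite /rp_step.
elim=> {s P} [x||s1 s2 P _ IH1 _ IH2|p s1 s2 P1 P2 _ IH1 _ IH2] /=.
- rewrite dbind_dirac /nplts_of_rplts /=; case: (t x a) => [D|].
    exact: denotes_tau1.
  by rewrite (proj1 htau); exact: DenStar.
- by rewrite dbind_dirac; exact: DenStar.
- exact: DenPlus.
- by rewrite dbind_dmix; exact: DenMix.
Qed.

Lemma denotes_run (R : realType) (A : Type) (X : choiceType)
    (t : rplts R A X) (tau : {fset dist R X} -> term R X) s P w :
  is_tau tau -> denotes s P ->
  denotes (term_run tau (nplts_of_rplts t) s w) (rp_run t P w).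
Proof.
move=> htau; elim: w s P => [//|a w IH] s P sP /=.
by apply: IH; exact: denotes_step.
Qed.

(** The map sending [P] to [1 - P None] preserves convex combinations, and max is idempotent. *)
Lemma denotes_out_may (R : realType) (X : choiceType) (s : term R X) P :
  denotes s P -> out_may s = 1 - P None.
Proof.
elim=> {s P} [x||s1 s2 P _ IH1 _ IH2|p s1 s2 P1 P2 _ IH1 _ IH2] /=.
- by rewrite diracE subr0.
- by rewrite diracE eqxx subrr.
- by rewrite IH1 IH2 maxxx.
- by rewrite IH1 IH2 dmixE; ring.
Qed.

Lemma denotes_out_must (R : realType) (X : choiceType) (s : term R X) P :
  denotes s P -> out_must s = 1 - P None.
Proof.
elim=> {s P} [x||s1 s2 P _ IH1 _ IH2|p s1 s2 P1 P2 _ IH1 _ IH2] /=.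
- by rewrite diracE subr0.
- by rewrite diracE eqxx subrr.
- by rewrite IH1 IH2 minxx.
- by rewrite IH1 IH2 dmixE; ring.
Qed.

(** Each interval operation computes its lower endpoint from lower endpoints only, so this holds for
    every term. *)
Lemma lo_out_maymust (R : realType) (X : choiceType) (s : term R X) :
  lo (out_maymust s) = out_must s.
Proof. by elim: s => [x||s1 IH1 s2 IH2|p s1 IH1 s2 IH2] //=; rewrite IH1 IH2. Qed.

Lemma hi_out_maymust (R : realType) (X : choiceType) (s : term R X) :
  hi (out_maymust s) = out_may s.
Proof. by elim: s => [x||s1 IH1 s2 IH2|p s1 IH1 s2 IH2] //=; rewrite IH1 IH2. Qed.

Theorem theorem7p8 (R : realType) (A : Type) (X : choiceType)
    (t : rplts R A X)
    (tau : {fset dist R X} -> term R X) (htau : is_tau tau) (x y : X) :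
  (rp_equiv t x y <-> maymust_equiv tau (nplts_of_rplts t) x y) /\
  (rp_equiv t x y <-> may_equiv tau (nplts_of_rplts t) x y) /\
  (rp_equiv t x y <-> must_equiv tau (nplts_of_rplts t) x y).
Proof.
have run z w := denotes_run t w htau (DenVar R z).
have mayE z w := denotes_out_may (run z w).
have mustE z w := denotes_out_must (run z w).
split; last split.
(* Conversely, the mass outside [None] is read off as the upper endpoint. *)
- split=> xy w; last by rewrite -!mayE -!hi_out_maymust xy.
  apply: itv01_inj; first by rewrite !lo_out_maymust !mustE.
  by rewrite !hi_out_maymust !mayE.
- by split=> xy w; have := xy w; rewrite !mayE.
- by split=> xy w; have := xy w; rewrite !mustE.
Qed.
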